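(* Let $\mathcal{H}$ and $\mathcal{G}$ be real Hilbert spaces, let $A\colon\mathcal{H}\to 2^{\mathcal{H}}$ be a maximally monotone operator, and let $L\colon\mathcal{H}\to\mathcal{G}$ be a bounded linear operator such that $LA^{-1}L^*$ is maximally monotone in $\mathcal{G}$. Moreover, let $U\colon\mathcal{G}\to\mathcal{G}$ be a self-adjoint strongly monotone bounded linear operator, and let $L\rhd A=(LA^{-1}L^* )^{-1}$. Then $U(L\rhd A)$ is maximally monotone in the Hilbert space $(\mathcal{G},\langle\cdot\mid\cdot\rangle_{U^{-1}})$ and the following hold: (i) $J_{U(L\rhd A)}=L(A+L^*U^{-1}L)^{-1}L^*U^{-1}$. (ii) Suppose that $\operatorname{ran}L$ is closed. Then $$J_{U(L\rhd A)}=LJ_A^{L^*U^{-1}L}(\sqrt{U}^{-1}L)^{\dagger}\sqrt{U}^{-1}.$$ (iii) Suppose that $\operatorname{ran}L^*=\mathcal{H}$. Then $$J_{U(L\rhd A)}=LJ_{(L^*U^{-1}L)^{-1}A}(L^*U^{-1}L)^{-1}L^*U^{-1}.$$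
   Context: For a set-valued operator $A\colon\mathcal{H}\to 2^{\mathcal{H}}$: $\operatorname{ran}A=\{u : \exists x,\ u\in Ax\}$, $\operatorname{gra}A=\{(x,u): u\in Ax\}$, $A^{-1}u=\{x : u\in Ax\}$, and the resolvent is $J_A=(\mathrm{Id}+A)^{-1}$, where $\mathrm{Id}$ is the identity operator. $A$ is monotone if $\langle x-y\mid u-v\rangle\ge 0$ for all $(x,u),(y,v)\in\operatorname{gra}A$; strongly monotone if there is $\alpha>0$ with $\langle x-y\mid u-v\rangle\ge\alpha\|x-y\|^2$ for all such pairs; maximally monotone if it is monotone and every $(x,u)$ satisfying $\langle x-y\mid u-v\rangle\ge 0$ for all $(y,v)\in\operatorname{gra}A$ belongs to $\operatorname{gra}A$. The operator $L\rhd A=(LA^{-1}L^* )^{-1}\colon\mathcal{G}\to2^{\mathcal{G}}$ is called the parallel composition of $A$ by $L$. Sums and compositions of set-valued operators are taken setwise (e.g. $(LT)x=\{Ly : y\in Tx\}$, $(TL)x=T(Lx)$ for a single-valued $L$), single-valued maps are viewed as set-valued operators with singleton values, and conversely operators with singleton values are identified with maps. For a strongly monotone self-adjoint bounded linear operator $V$ on a Hilbert space, $\langle x\mid y\rangle_V=\langle x\mid Vy\rangle$. $\sqrt{U}$ is the positive self-adjoint square root of $U$ and $\sqrt{U}^{-1}$ is its inverse. For an operator $K\colon\mathcal{H}\to\mathcal{H}$, the warped resolvent of $A$ with kernel $K$ is $J_A^K=(K+A)^{-1}K$ (a possibly set-valued operator). $L^*$ is the adjoint of a bounded linear operator $L$.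 If $L\colon\mathcal{H}\to\mathcal{G}$ has closed range, its Moore–Penrose inverse $L^\dagger\colon\mathcal{G}\to\mathcal{H}$ maps $y$ to the minimal-norm element of $\{x\in\mathcal{H} : L^*Lx=L^*y\}$. *)

(* Defs.v *)
From HB Require Import structures.
From mathcomp Require Import all_boot all_order all_algebra.
From mathcomp Require Import all_classical all_reals all_analysis.
Set Implicit Arguments.
Unset Strict Implicit.
Unset Printing Implicit Defensive.
Import Order.TTheory GRing.Theory Num.Theory.
Import numFieldNormedType.Exports.
Local Open Scope classical_set_scope.
Local Open Scope ring_scope.

HB.mixin Record CompleteNormedModule_isHilbert (R : realType) V
    & CompleteNormedModule R V := {
  inner : V -> V -> R ;
  inner_sym : forall x y, inner x y = inner y x ;
  inner_linearl : forall (a : R) x y z,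
    inner (a *: x + y) z = a * inner x z + inner y z ;
  inner_normE : forall x, inner x x = `|x| ^+ 2
}.

#[short(type="hilbertType")]
HB.structure Definition Hilbert (R : realType) :=
  {V of CompleteNormedModule R V & CompleteNormedModule_isHilbert R V}.

(* [ip] turns the vector space [V] into a Hilbert space; its norm is not
   assumed to be the one [V] comes with. *)
Record hilbert_inner_product (R : realType) (V : lmodType R)
    (ip : V -> V -> R) : Prop := {
  hip_sym : forall x y, ip x y = ip y x ;
  hip_linearl : forall (a : R) x y z,
    ip (a *: x + y) z = a * ip x z + ip y z ;
  hip_gt0 : forall x, x != 0 -> 0 < ip x x ;
  hip_complete : forall u : nat -> V,
    (forall e : R, 0 < e -> exists N, forall m n, (N <= m)%N -> (N <= n)%N ->
      Num.sqrt (ip (u m - u n) (u m - u n)) < e) ->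
    exists l, forall e : R, 0 < e -> exists N, forall n, (N <= n)%N ->
      Num.sqrt (ip (u n - l) (u n - l)) < e
}.

Definition op_of (T S : Type) (f : T -> S) : T -> set S := fun x => [set f x].

Definition op_inv (T S : Type) (A : T -> set S) : S -> set T :=
  fun u => [set x | A x u].

Definition op_comp (T S X : Type) (B : S -> set X) (A : T -> set S) :
  T -> set X := fun x => \bigcup_(y in A x) B y.

Definition op_add (T : Type) (V : zmodType) (A B : T -> set V) : T -> set V :=
  fun x => [set u + v | u in A x & v in B x].

(* The map identified with an operator [A] whose values are singletons. Its
   value at [x] is meaningful only if [A x] is a singleton. *)
Definition map_of (T : Type) (V : zmodType) (A : T -> set V) : T -> V :=
  fun x => xget 0 (A x).

Notation "f %:op" := (op_of f) (at level 1, left associativity, format "f %:op").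
Notation "A ^-1o" := (op_inv A) (at level 1, left associativity, format "A ^-1o").
Notation "B \oc A" := (op_comp B A)
  (at level 50, left associativity, format "B  \oc  A").
Notation "A \+o B" := (op_add A B)
  (at level 50, left associativity, format "A  \+o  B").

Definition resolvent (V : zmodType) (A : V -> set V) : V -> set V :=
  (idfun%:op \+o A)^-1o.

Definition warped_resolvent (V : zmodType) (K : V -> V) (A : V -> set V) :
  V -> set V := (K%:op \+o A)^-1o \oc K%:op.

Definition monotone_op (R : realType) (V : lmodType R) (ip : V -> V -> R)
    (A : V -> set V) :=
  forall x u y v, A x u -> A y v -> 0 <= ip (x - y) (u - v).

Definition maximally_monotone (R : realType) (V : lmodType R)
    (ip : V -> V -> R) (A : V -> set V) :=
  monotone_op ip A /\
  forall x u, (forall y v, A y v -> 0 <= ip (x - y) (u - v)) -> A x u.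

Definition strongly_monotone (R : realType) (V : hilbertType R)
    (A : V -> set V) :=
  exists2 alpha : R, 0 < alpha &
    forall x u y v, A x u -> A y v ->
      alpha * `|x - y| ^+ 2 <= inner (x - y) (u - v).

Section Operators.
Context {R : realType} {V W : hilbertType R}.

Definition inner_op (T : V -> V) (x y : V) : R := inner x (T y).

(* For linear [T] this is [exists M, forall x, `|T x| <= M * `|x|], by
   [linear_boundedP]. *)
Definition bounded_operator (T : V -> W) : Prop := bounded_near T (nbhs (0 : V)).

(* For [T] bounded and linear, the element chosen at [y] exists and is unique
   by the Riesz representation theorem. *)
Definition adjoint (T : V -> W) : W -> V :=
  fun y => xget 0 [set x | forall z, inner (T z) y = inner z x].

Definition parallel_composition (T : V -> W) (A : V -> set V) : W -> set W :=
  (T%:op \oc A^-1o \oc (adjoint T)%:op)^-1o.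

(* Meant for [T] with closed range: the element chosen then exists and is
   unique. *)
Definition moore_penrose (T : V -> W) : W -> V :=
  fun y => xget 0 [set x | adjoint T (T x) = adjoint T y /\
    forall z, adjoint T (T z) = adjoint T y -> `|x| <= `|z|].

End Operators.

Definition self_adjoint (R : realType) (V : hilbertType R) (T : V -> V) :=
  adjoint T = T.

(* A positive self-adjoint bounded linear operator has exactly one such root. *)
Definition sqrt_op (R : realType) (V : hilbertType R) (T : V -> V) : V -> V :=
  xget (fun=> 0) [set S : V -> V | [/\ linear S, bounded_operator S,
    self_adjoint S, (forall x, 0 <= inner x (S x)) & forall x, S (S x) = T x]].

(* Main.v *)
Require Import Defs.
From HB Require Import structures.
From mathcomp Require Import all_boot all_order all_algebra.
From mathcomp Require Import all_classical all_reals all_analysis.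
From mathcomp Require Import ring lra.
Import Order.TTheory GRing.Theory Num.Theory.
Import numFieldNormedType.Exports.
Set Implicit Arguments.
Unset Strict Implicit.
Unset Printing Implicit Defensive.
Local Open Scope classical_set_scope.
Local Open Scope ring_scope.

(** The resolvent identities reduce to one computation. By definition
    [y] lies in [x + U u] with [u] in [(L |> A) x] iff there is [z] with
    [x = L z] and [L^* u] in [A z]; since [u = U^-1 (y - x)], the second
    condition reads [L^* U^-1 y] in [A z + K z], where [K = L^* U^-1 L]. This
    is (i), [resolvent_parallel_composition]. The maximal monotonicity of
    [U (L |> A)] for [U^-1] is that of [L |> A] for the original inner product,
    because [inner (x - y) (U^-1 (U u - U v)) = inner (x - y) (u - v)]
    ([maximally_monotone_preconditioned]), and [U^-1] yields an equivalent
    Hilbert norm ([hilbert_inner_product_op]).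

    For (ii), put [S = sqrt U] and [T = S^-1 L]. Then [T^* T = K] and
    [T^* S^-1 = L^* U^-1], so the normal equation [T^* T T^+ = T^*] of the
    Moore-Penrose inverse ([moore_penrose_normal_eq]) turns
    [(K + A)^-1 K T^+ S^-1] into [(K + A)^-1 L^* U^-1]. For (iii), when [K] is
    surjective, [(Id + K^-1 A)^-1 K^-1 = (K + A)^-1] as set-valued operators
    ([resolvent_preconditioned]).

    The rest is Hilbert space theory making these formulas meaningful.
    - Nearest points in closed convex sets ([closest_point]) give the Riesz
      representation and hence adjoints, and also, used twice, the existence
      of the Moore-Penrose inverse.
    - A strongly monotone bounded [T] makes [Id - t T] a contraction for some
      [t > 0] ([strongly_monotone_step]). The Banach fixed point theorem then
      inverts [T], and when [T] is self-adjoint its square root comes from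
      iterating [Y -> (B + Y ^ 2) / 2] with [B = Id - t T] ([sqrt_opP]).
    - If [L^*] is surjective, the uniform boundedness principle bounds [L] below
      ([adjoint_surj_bounded_below]), so [K] is strongly monotone, hence
      surjective. *)

(** * Inner products and nearest points *)

Section InnerProduct.
Context {R : realType} {V : hilbertType R}.
Implicit Types (x y z : V) (a : R).

Lemma innerDl x y z : inner (x + y) z = inner x z + inner y z.
Proof. by rewrite -[x]scale1r inner_linearl mul1r scale1r. Qed.

Lemma inner0l x : inner 0 x = 0 :> R.
Proof. by apply: (addrI (inner 0 x)); rewrite -innerDl !addr0. Qed.

Lemma innerZl a x z : inner (a *: x) z = a * inner x z.
Proof. by rewrite -[a *: x]addr0 inner_linearl inner0l addr0. Qed.

Lemma innerNl x z : inner (- x) z = - inner x z.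
Proof. by rewrite -scaleN1r innerZl mulN1r. Qed.

Lemma innerBl x y z : inner (x - y) z = inner x z - inner y z.
Proof. by rewrite innerDl innerNl. Qed.

Lemma inner0r x : inner x 0 = 0 :> R.
Proof. by rewrite inner_sym inner0l. Qed.

Lemma innerDr x y z : inner z (x + y) = inner z x + inner z y.
Proof. by rewrite !(inner_sym z) innerDl. Qed.

Lemma innerZr a x z : inner z (a *: x) = a * inner z x.
Proof. by rewrite !(inner_sym z) innerZl. Qed.

Lemma innerBr x y z : inner z (x - y) = inner z x - inner z y.
Proof. by rewrite !(inner_sym z) innerBl. Qed.

Lemma inner_ge0 x : 0 <= inner x x.
Proof. by rewrite inner_normE sqr_ge0. Qed.

Lemma inner_eq0 x : inner x x = 0 -> x = 0.
Proof. by move/eqP; rewrite inner_normE sqrf_eq0 normr_eq0 => /eqP. Qed.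

Lemma inner_ext x y : (forall z, inner z x = inner z y) -> x = y.
Proof.
move=> xy; apply/subr0_eq/inner_eq0.
by rewrite innerBr xy subrr.
Qed.

Lemma sqr_normD x y : `|x + y| ^+ 2 = `|x| ^+ 2 + inner x y *+ 2 + `|y| ^+ 2.
Proof.
rewrite -!inner_normE !innerDl !innerDr (inner_sym y x); ring.
Qed.

Lemma sqr_normB x y : `|x - y| ^+ 2 = `|x| ^+ 2 - inner x y *+ 2 + `|y| ^+ 2.
Proof. by rewrite sqr_normD normrN inner_sym innerNl inner_sym mulNrn. Qed.

(** Comparing [w] with the foot [t *: v] of its perpendicular on the line of
    [v] decreases the squared norm by [inner w v ^+ 2 / inner v v]. *)
Lemma minimal_orthogonal (w v : V) :
  (forall t : R, `|w| <= `|w - t *: v|) -> inner w v = 0.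
Proof.
move=> /(_ (inner w v / inner v v)) min_w.
have [->|v0] := eqVneq v 0; first by rewrite inner0r.
have vv : 0 < inner v v by rewrite inner_normE exprn_gt0 ?normr_gt0.
move: min_w; rewrite -(@ler_pXn2r _ 2) ?nnegrE// sqr_normB normrZ exprMn.
rewrite real_normK ?num_real// -(inner_normE v) innerZr.
have -> : `|w| ^+ 2 - (inner w v / inner v v * inner w v) *+ 2 +
    (inner w v / inner v v) ^+ 2 * inner v v =
    `|w| ^+ 2 - inner w v ^+ 2 / inner v v by field; rewrite gt_eqF.
rewrite lerDl oppr_ge0 pmulr_lle0 ?invr_gt0// => wv_le0.
by apply/eqP; rewrite -sqrf_eq0 eq_le wv_le0 sqr_ge0.
Qed.

Lemma cauchy_schwarz x y : `|inner x y| <= `|x| * `|y|.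
Proof.
have [->|y0] := eqVneq y 0; first by rewrite inner0r !normr0 mulr0.
have yy : 0 < inner y y by rewrite inner_normE exprn_gt0 ?normr_gt0.
rewrite -(@ler_pXn2r _ 2) ?nnegrE// ?mulr_ge0// exprMn real_normK ?num_real//.
rewrite -!inner_normE.
have := inner_ge0 (x - (inner x y / inner y y) *: y).
rewrite !innerBl !innerBr !innerZl !innerZr (inner_sym y x) => h.
have -> : inner x x * inner y y = inner x y ^+ 2 +
  (inner x x - inner x y / inner y y * inner x y -
   (inner x y / inner y y * inner x y -
    inner x y / inner y y * (inner x y / inner y y * inner y y))) * inner y y.
  by field; rewrite gt_eqF.
by rewrite lerDl mulr_ge0// ltW.
Qed.

Lemma inner_continuous z : continuous (fun x : V => inner x z : R^o).
Proof.
move=> x; apply/(@cvgrPdist_lt _ _ _ (nbhs x)) => e e0.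
have z1 : 0 < `|z| + 1 by rewrite ltr_wpDl.
near=> t; rewrite -innerBl (le_lt_trans (cauchy_schwarz _ _))//.
rewrite (@le_lt_trans _ _ (`|x - t| * (`|z| + 1)))//.
  by rewrite ler_wpM2l// lerDl.
rewrite -ltr_pdivlMr//; near: t.
by apply: cvgr_dist_lt; rewrite // divr_gt0.
Unshelve. all: by end_near. Qed.

Lemma cauchy_seq_cvg (u : nat -> V) :
  (forall e : R, 0 < e -> exists N, forall m n, (N <= m)%N -> (N <= n)%N ->
     `|u m - u n| < e) -> cvgn u.
Proof.
move=> u_cauchy; apply/cauchy_cvgP/cauchy_exP => e e0.
have [N uN] := u_cauchy e e0; exists (u N); exists N => // n /= Nn.
by rewrite -ball_normE /=; apply: uN.
Qed.

(** Existence of a nearest point: by the parallelogram identity, almost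
    minimizing points of [C] have an almost minimizing midpoint and are
    therefore close to each other, so that minimizing sequences converge. *)
Lemma closest_point (C : set V) (y : V) :
  closed C -> C !=set0 ->
  (forall v w, C v -> C w -> C (2^-1 *: (v + w))) ->
  exists2 p, C p & forall z, C z -> `|y - p| <= `|y - z|.
Proof.
move=> C_closed [c Cc] C_mid.
have [d [d_le d_adh]] : exists d : R,
    (forall z, C z -> d <= `|y - z| ^+ 2) /\
    (forall e, 0 < e -> exists2 z, C z & `|y - z| ^+ 2 < d + e).
  pose D := [set `|y - z| ^+ 2 | z in C].
  have D_inf : has_inf D.
    split; first by exists (`|y - c| ^+ 2), c.
    by exists 0 => _ [z _ <-]; exact: sqr_ge0.
  exists (inf D); split=> [z Cz|e e0].
    by apply: (ge_inf D_inf.2); exists z.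
  by have [_ [z Cz <-] zd] := inf_adherent e0 D_inf; exists z.
have /choice[u u_min] n : exists z, C z /\ `|y - z| ^+ 2 < d + n.+1%:R^-1.
  have n0 : 0 < n.+1%:R^-1 :> R by rewrite invr_gt0.
  by have [z Cz zd] := d_adh _ n0; exists z.
have u_close m n : `|u m - u n| ^+ 2 <= (m.+1%:R^-1 + n.+1%:R^-1) *+ 2.
  have [[Cm um] [Cn un]] := (u_min m, u_min n).
  have := d_le _ (C_mid _ _ Cm Cn).
  set w := _ *: _.
  have -> : `|y - w| ^+ 2 = (`|y - u m| ^+ 2 + `|y - u n| ^+ 2) / 2 -
      `|u m - u n| ^+ 2 / 4.
    rewrite /w -!inner_normE.
    rewrite !(innerBl, innerBr, innerDl, innerDr, innerZl, innerZr).
    rewrite (inner_sym y (u m)) (inner_sym y (u n)) (inner_sym (u m) (u n)).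
    by field.
  move: um un; move: (m.+1%:R^-1) (n.+1%:R^-1) => s t.
  move: (`|y - u m| ^+ 2) (`|y - u n| ^+ 2) (`|u m - u n| ^+ 2) => a b c'.
  lra.
have u_cvg : cvgn u.
  apply: cauchy_seq_cvg => e e0.
  have e2 : 0 < e ^+ 2 / 4 by rewrite divr_gt0 ?exprn_gt0.
  have [N _ uN] := near_infty_natSinv_lt (PosNum e2).
  exists N => m n Nm Nn.
  rewrite -(@ltr_pXn2r _ 2) ?nnegrE ?(ltW e0)//.
  apply: le_lt_trans (u_close m n) _.
  have := uN m Nm; have := uN n Nn; rewrite /=.
  by move: (m.+1%:R^-1) (n.+1%:R^-1) => s t um un; lra.
have up : u n @[n --> \oo] --> limn u by [].
exists (limn u) => [|z Cz].
  by apply: closed_cvg up => //; apply: nearW => n; case: (u_min n).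
rewrite -(@ler_pXn2r _ 2) ?nnegrE//; apply: le_trans (d_le _ Cz).
have lim1 : `|y - u n| ^+ 2 @[n --> \oo] --> `|y - limn u| ^+ 2.
  have h : `|y - u n| @[n --> \oo] --> `|y - limn u|.
    by apply: cvg_norm; apply: cvgB => //; exact: cvg_cst.
  by rewrite expr2; under eq_fun do rewrite expr2; exact: cvgM.
have lim2 : d + n.+1%:R^-1 @[n --> \oo] --> d.
  rewrite -[X in _ --> X]addr0; apply: cvgD; first exact: cvg_cst.
  exact: cvg_harmonic.
apply: (ler_cvg_to lim1 lim2); apply: nearW => n.
by apply: ltW; case: (u_min n).
Qed.

End InnerProduct.

(** * Adjoints and least squares *)

Section Bundling.
Context {R : realType} {V W : lmodType R}.

Lemma linear_bundle (f : V -> W) :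
  linear f -> exists g : {linear V -> W}, f = g.
Proof.
move=> f_lin.
pose g : {linear V -> W} := HB.pack f (GRing.isLinear.Build _ _ _ _ _ f_lin).
by exists g.
Qed.

End Bundling.

Section Bounded.
Context {R : realType} {V W : hilbertType R}.

Lemma bounded_operatorP (T : {linear V -> W}) :
  bounded_operator T <-> exists2 M : R, 0 < M & forall x, `|T x| <= M * `|x|.
Proof.
split=> [/linear_boundedP/pinfty_ex_gt0[M M0 TM]|[M M0 TM]]; first by exists M.
apply/linear_boundedP; exists M; split; first exact: gtr0_real.
by move=> r Mr x; rewrite (le_trans (TM x))// ler_wpM2r// ltW.
Qed.

(** The representing vector is a multiple of the element of minimal norm in
    the hyperplane of equation [f = 1]. *)
Lemma riesz (f : {linear V -> R^o}) :
  continuous (f : V -> R^o) -> exists x, forall z, f z = inner z x.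
Proof.
move=> f_cont.
have [f0|/existsNP[x0 /eqP fx0]] := pselect (forall z, f z = 0).
  by exists 0 => z; rewrite f0 inner0r.
pose C := [set x | f x = 1].
have [|||p Cp p_min] := @closest_point R V C 0.
- apply: (@closed_comp _ _ (f : V -> R^o) [set 1]) => [x _|].
    exact: f_cont.
  exact: closed_eq.
- by exists ((f x0)^-1 *: x0); rewrite /C/= linearZ/= /GRing.scale/= mulVf.
- move=> v w; rewrite /C/= => fv fw.
  by rewrite linearZ/= linearD fv fw /GRing.scale/=; field.
have p_orth z : f z = 0 -> inner p z = 0.
  move=> fz; apply: minimal_orthogonal => t.
  have := p_min (p - t *: z); rewrite !sub0r !normrN; apply.
  by rewrite /C/= linearB linearZ fz/= scaler0 subr0.
have pp : inner p p != 0 :> R.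
  apply/eqP => /inner_eq0 p0; move: Cp; rewrite /C/= p0 linear0.
  by move/esym/eqP; rewrite oner_eq0.
exists ((inner p p)^-1 *: p) => z.
have := p_orth (z - f z *: p).
rewrite linearB linearZ/= Cp [f z *: 1]mulr1 subrr => /(_ erefl).
rewrite innerBr innerZr => /eqP; rewrite subr_eq0 => /eqP pz.
by rewrite innerZr inner_sym pz mulrCA mulVf ?mulr1.
Qed.

Lemma adjoint_unique (T : V -> W) (y : W) (x : V) :
  (forall z, inner (T z) y = inner z x) -> adjoint T y = x.
Proof.
move=> Tx; rewrite /adjoint; case: xgetP => [x' _ Tx'|/(_ x)//].
by apply: inner_ext => z; rewrite -Tx' Tx.
Qed.

Lemma adjointE (T : {linear V -> W}) (y : W) (z : V) :
  bounded_operator T -> inner (T z) y = inner z (adjoint T y).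
Proof.
move=> T_bounded; rewrite /adjoint.
case: xgetP => [x _ ->//|no_x].
have f_lin : linear (fun v => inner (T v) y : R^o).
  by move=> a v w; rewrite linearP innerDl innerZl.
have [f fE] := linear_bundle f_lin.
have [|x fx] := @riesz f; last by case: (no_x x) => v; rewrite -fx -fE.
rewrite -fE => v; apply: (@continuous_comp _ _ _ T (fun w => inner w y : R^o)).
  by move: v; exact/linear_bounded_continuous.
exact: inner_continuous.
Qed.

Lemma adjoint_linear (T : {linear V -> W}) :
  bounded_operator T -> linear (adjoint T).
Proof.
move=> T_bounded a y w; apply: adjoint_unique => z.
by rewrite innerDr innerZr !adjointE// innerDr innerZr.
Qed.

(** With [p] the point of the range of [T] nearest to [y], the least squares
    solutions are the solutions of [T x = p]: a closed affine subspace, which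
    has an element of minimal norm. *)
Lemma moore_penrose_normal_eq (T : {linear V -> W}) (y : W) :
  bounded_operator T -> closed (range T) ->
  adjoint T (T (moore_penrose T y)) = adjoint T y.
Proof.
move=> T_bounded T_closed.
have [||p [x0 _ Tx0] p_min] := closest_point y T_closed.
- by exists 0, 0; rewrite ?linear0.
- move=> _ _ [x0 _ <-] [x1 _ <-]; exists (2^-1 *: (x0 + x1)) => //.
  by rewrite linearZ/= linearD.
have p_orth z : inner (y - p) (T z) = 0.
  apply: minimal_orthogonal => t.
  have := p_min (T (x0 + t *: z)) (imageP _ I).
  by rewrite linearD linearZ/= Tx0 opprD addrA.
have normal_eqP x : adjoint T (T x) = adjoint T y <-> T x = p.
  have x0_normal : adjoint T p = adjoint T y.
    apply: inner_ext => z; rewrite -!adjointE//; apply/esym/eqP.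
    by rewrite -subr_eq0 -innerBr inner_sym p_orth.
  split=> [|->//]; rewrite -x0_normal -Tx0 => T2x.
  apply/subr0_eq; rewrite -linearB; apply: inner_eq0.
  by rewrite [X in inner _ X]linearB innerBr !adjointE// T2x subrr.
have [|||x Tx x_min] := @closest_point R V [set x | T x = p] 0.
- apply: (@closed_comp _ _ T [set p]) => [x _|]; last first.
    exact/accessible_closed_set1/hausdorff_accessible/norm_hausdorff.
  by move: x; exact/linear_bounded_continuous.
- by exists x0.
- move=> v w /= Tv Tw; rewrite linearZ/= linearD Tv Tw.
  rewrite -[p + p]mulr2n -[p *+ 2]scaler_nat.
  by rewrite scalerA mulVf ?scale1r// pnatr_eq0.
rewrite /moore_penrose; case: xgetP => [_ -> []//|/(_ x)[]].
split=> [|z /normal_eqP Tz]; first exact/normal_eqP.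
by have := x_min z Tz; rewrite !sub0r !normrN.
Qed.

End Bounded.

Lemma adjoint_bounded (R : realType) (V W : hilbertType R)
    (T : {linear V -> W}) :
  bounded_operator T -> bounded_operator (adjoint T).
Proof.
move=> T_bounded; have /bounded_operatorP[M M0 TM] := T_bounded.
have [Ts TsE] := linear_bundle (adjoint_linear T_bounded).
rewrite TsE; apply/bounded_operatorP; exists M => // y; rewrite -TsE.
have [->|y0] := eqVneq (adjoint T y) 0; first by rewrite normr0 mulr_ge0// ltW.
rewrite -(@ler_pM2r _ `|adjoint T y|) ?normr_gt0// -expr2 -inner_normE.
rewrite -adjointE// (le_trans (ler_norm _))// (le_trans (cauchy_schwarz _ _))//.
by rewrite mulrAC ler_wpM2r.
Qed.

Lemma self_adjointE (R : realType) (V : hilbertType R) (T : {linear V -> V})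
    (x y : V) :
  bounded_operator T -> self_adjoint T -> inner (T x) y = inner x (T y).
Proof. by move=> T_bounded T_sa; rewrite adjointE// T_sa. Qed.

Lemma bounded_operator_comp (R : realType) (V W X : hilbertType R)
    (f : {linear W -> X}) (g : {linear V -> W}) :
  bounded_operator f -> bounded_operator g -> bounded_operator (f \o g).
Proof.
move=> /bounded_operatorP[M M0 fM] /bounded_operatorP[N N0 gN].
apply/bounded_operatorP; exists (M * N) => [|x]; first exact: mulr_gt0.
by rewrite (le_trans (fM _))// -mulrA ler_pM2l.
Qed.

(** * Inversion of strongly monotone operators *)

Section Inverse.
Context {S : Type} {V : zmodType}.
Variable f : V -> S.
Hypothesis f_surj : forall y, exists x, f x = y.

Lemma map_of_invK : cancel (map_of f%:op^-1o) f.
Proof.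
move=> y; rewrite /map_of; case: xgetP => [x _ ->//|no_x].
by have [x fx] := f_surj y; case: (no_x x).
Qed.

End Inverse.

Section Contraction.
Context {R : realType} {V : completeNormedModType R}.

Lemma contraction_fixed_point (f : V -> V) (q : R) :
  0 <= q < 1 -> (forall x y, `|f x - f y| <= q * `|x - y|) ->
  exists x, x = f x.
Proof.
move=> /andP[q0 q1] f_lip.
have f_fun : isFun V V setT setT f by split.
pose g : {fun [set: V] >-> [set: V]} := HB.pack f f_fun.
have g_contr : is_contraction g.
  by exists (NngNum q0); split=> // -[x y] _; exact: f_lip.
have [|x _ fx] := banach_fixed_point g_contr closedT; first by exists 0.
by exists x.
Qed.

Lemma geometric_seq_cvg (u : nat -> V) (C q : R) :
  0 <= q < 1 -> (forall n, `|u n.+1 - u n| <= C * q ^+ n) -> cvgn u.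
Proof.
move=> /andP[q0 q1] u_geo.
have : cvgn (series (telescope u)).
  apply: normed_cvg; apply: (@series_le_cvg _ _ (geometric C q)) => [n|n|n|].
  - exact: normr_ge0.
  - exact: le_trans (u_geo n).
  - exact: u_geo.
  - by apply: is_cvg_geometric_series; rewrite ger0_norm.
move=> tu_cvg; have -> : u = (fun n => u 0%N + series (telescope u) n).
  by apply/funext => n; exact: eq_sum_telescope.
by apply: is_cvgD => //; exact: is_cvg_cst.
Qed.

End Contraction.

Section StronglyMonotone.
Context {R : realType} {V : hilbertType R}.

Lemma linear_strongly_monotoneP (T : {linear V -> V}) :
  strongly_monotone T%:op <->
  exists2 a : R, 0 < a & forall x, a * `|x| ^+ 2 <= inner x (T x).
Proof.
split=> -[a a0 Ta]; exists a => // x.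
  by have := Ta x _ 0 _ erefl erefl; rewrite [T 0]linear0 !subr0.
by move=> u y v -> ->; rewrite -linearB.
Qed.

(** For a small step [t], [Id - t T] contracts since the squared norm of
    [x - t T x] is at most [(1 - 2 t a + t ^ 2 M ^ 2) |x| ^ 2]; [t = a / M ^ 2]
    minimizes the factor. *)
Lemma strongly_monotone_step (T : {linear V -> V}) :
  bounded_operator T -> strongly_monotone T%:op ->
  exists t q : R, [/\ 0 < t, 0 <= q < 1 &
    forall x, `|x - t *: T x| <= q * `|x|].
Proof.
move=> /bounded_operatorP[M0 M0_gt0 TM0] /linear_strongly_monotoneP[a a0 Ta].
(* Enlarging the bound to [M > a] makes the factor positive. *)
pose M := M0 + a.
have aM : a < M by rewrite ltrDr.
have M_gt0 : 0 < M := lt_trans a0 aM.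
have TM x : `|T x| <= M * `|x|.
  by rewrite (le_trans (TM0 x))// ler_wpM2r// lerDl ltW.
pose r := 1 - (a / M) ^+ 2.
have r01 : 0 <= r < 1.
  have aM0 : 0 < a / M by rewrite divr_gt0.
  rewrite subr_ge0 expr_le1 ?ltW ?ltr_pdivrMr ?mul1r//.
  by rewrite ltrBlDr ltrDl exprn_gt0.
have [r0 r1] := andP r01.
exists (a / M ^+ 2), (Num.sqrt r); split.
- by rewrite divr_gt0 ?exprn_gt0.
- by rewrite sqrtr_ge0 -[ltRHS]sqrtr1 ltr_sqrt.
move=> x; rewrite -(@ler_pXn2r _ 2) ?nnegrE ?mulr_ge0 ?sqrtr_ge0//.
rewrite exprMn sqr_sqrtr// sqr_normB normrZ exprMn real_normK ?num_real//.
rewrite innerZr.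
have Tx2 : `|T x| ^+ 2 <= M ^+ 2 * `|x| ^+ 2.
  by rewrite -exprMn ler_pXn2r ?nnegrE ?mulr_ge0// ltW.
have -> : r * `|x| ^+ 2 = `|x| ^+ 2 - (a / M ^+ 2 * (a * `|x| ^+ 2)) *+ 2 +
    (a / M ^+ 2) ^+ 2 * (M ^+ 2 * `|x| ^+ 2).
  by rewrite /r; field; rewrite gt_eqF.
apply: lerD; last by rewrite ler_wpM2l// sqr_ge0.
by rewrite lerD2l lerN2 lerMn2r /= ler_wpM2l// divr_ge0 ?exprn_ge0 ?ltW.
Qed.

(** A solution of [T x = y] is a fixed point of the contraction
    [x - t (T x - y)]. *)
Lemma strongly_monotone_surj (T : {linear V -> V}) :
  bounded_operator T -> strongly_monotone T%:op -> forall y, exists x, T x = y.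
Proof.
move=> T_bounded T_mono y.
have [t [q [t0 q01 Tq]]] := strongly_monotone_step T_bounded T_mono.
pose f x := x - t *: (T x - y).
have [|x fx] := @contraction_fixed_point _ _ f q q01.
  move=> x z; rewrite /f; have -> : x - t *: (T x - y) - (z - t *: (T z - y)) =
      (x - z) - t *: T (x - z).
    have -> : t *: T (x - z) = t *: (T x - y) - t *: (T z - y).
      by rewrite linearB -scalerBr opprB addrA subrK.
    by rewrite !opprD !opprK addrACA.
  exact: Tq.
exists x; apply/subr0_eq/eqP; move/eqP: fx; rewrite /f.
rewrite eq_sym -subr_eq0 addrAC subrr add0r oppr_eq0 scaler_eq0.
by rewrite gt_eqF.
Qed.

Lemma strongly_monotone_inj (T : {linear V -> V}) :
  strongly_monotone T%:op -> injective T.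
Proof.
move=> /linear_strongly_monotoneP[a a0 Ta] x y Txy.
apply/subr0_eq/eqP; rewrite -normr_eq0 -sqrf_eq0 eq_le sqr_ge0 andbT.
by have := Ta (x - y); rewrite linearB Txy subrr inner0r pmulr_rle0.
Qed.

End StronglyMonotone.

(** * Square roots *)

Section SquareRoot.
Context {R : realType} {V : hilbertType R}.

Section Iteration.
Variables (B : {linear V -> V}) (q : R).
Hypothesis q01 : 0 <= q < 1.
Hypothesis B_bound : forall x, `|B x| <= q * `|x|.
Hypothesis B_sym : forall x y, inner (B x) y = inner x (B y).

(** The limit plays the role of [Id - sqrt (Id - B)], the small solution of
    [2 Y = B + Y ^ 2]. *)
Fixpoint half_square_iter (n : nat) : V -> V :=
  if n is n'.+1 then
    fun x => 2^-1 *: (B x + half_square_iter n' (half_square_iter n' x))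
  else fun=> 0.
Local Notation Y := half_square_iter.

Let q0 : 0 <= q. Proof. by case/andP: q01. Qed.
Let q1 : q < 1. Proof. by case/andP: q01. Qed.

Lemma half_square_iterP n a x y : Y n (a *: x + y) = a *: Y n x + Y n y.
Proof.
elim: n x y => [|n IHn] x y /=; first by rewrite scaler0 addr0.
rewrite linearP !IHn !scalerDr !scalerA (mulrC 2^-1).
by rewrite addrACA.
Qed.

Lemma half_square_iterB n x y : Y n (x - y) = Y n x - Y n y.
Proof. by rewrite addrC -scaleN1r half_square_iterP scaleN1r addrC. Qed.

Lemma half_square_iter_sym n x y : inner (Y n x) y = inner x (Y n y).
Proof.
elim: n x y => [|n IHn] x y /=; first by rewrite inner0l inner0r.
by rewrite innerZl innerZr innerDl innerDr B_sym !IHn.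
Qed.

Lemma half_square_iter_bound n x : `|Y n x| <= q * `|x|.
Proof.
elim: n x => [|n IHn] x /=; first by rewrite normr0 mulr_ge0.
rewrite normrZ gtr0_norm ?invr_gt0// ler_pdivrMl// (le_trans (ler_normD _ _))//.
rewrite mulr_natl mulr2n lerD// (le_trans (IHn _))// ler_wpM2l//.
by rewrite (le_trans (IHn _))// ler_piMl// ltW.
Qed.

(** As [Y n.+1 ^ 2 - Y n ^ 2] is
    [Y n.+1 (Y n.+1 - Y n) + (Y n.+1 - Y n) Y n], the distance of consecutive
    iterates shrinks by the factor [q]. *)
Lemma half_square_iter_step n x : `|Y n.+1 x - Y n x| <= `|x| * q ^+ n.
Proof.
elim: n x => [|n IHn] x.
  rewrite subr0 expr0 mulr1 (le_trans (half_square_iter_bound 1 x))//.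
  by rewrite ler_piMl// ltW.
have -> : Y n.+2 x - Y n.+1 x = 2^-1 *:
    (Y n.+1 (Y n.+1 x - Y n x) + (Y n.+1 (Y n x) - Y n (Y n x))).
  rewrite half_square_iterB addrA subrK.
  by rewrite [Y n.+2]/= {2}[Y n.+1]/= -scalerBr opprD addrACA subrr add0r.
rewrite normrZ gtr0_norm ?invr_gt0// ler_pdivrMl// (le_trans (ler_normD _ _))//.
rewrite mulr_natl mulr2n exprS mulrCA lerD//.
  rewrite (le_trans (half_square_iter_bound n.+1 _))// ler_wpM2l//.
rewrite (le_trans (IHn _))// mulrA ler_wpM2r ?exprn_ge0//.
exact: half_square_iter_bound.
Qed.

(** Pointwise limits suffice: the uniform bound [q] on the iterates lets
    [Y n (Y n x)] converge to the square of the limit, and the remaining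
    properties are closed under pointwise limits. *)
Lemma half_square_fixed_point : exists Z : V -> V,
  [/\ linear Z, forall x, `|Z x| <= q * `|x|,
      forall x y, inner (Z x) y = inner x (Z y) &
      forall x, Z x + Z x = B x + Z (Z x)].
Proof.
have Y_cvg x : cvgn (Y^~ x).
  by apply: (geometric_seq_cvg q01) => n; exact: half_square_iter_step.
pose Z x := limn (Y^~ x).
have YZ x : Y n x @[n --> \oo] --> Z x by exact: Y_cvg.
have Z_lin : linear Z.
  move=> a x y; apply: cvg_lim => //.
  under eq_fun do rewrite half_square_iterP.
  by apply: cvgD => //; exact: cvgZr.
have Z_bound x : `|Z x| <= q * `|x|.
  have Y_norm : `|Y n x| @[n --> \oo] --> `|Z x| by exact: cvg_norm.
  apply: (cvgr_to_le Y_norm).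
  by apply: nearW => n; exact: half_square_iter_bound.
exists Z; split=> // [x y|x].
  have lim1 : inner (Y n x) y @[n --> \oo] --> inner (Z x) y.
    exact: (continuous_cvg _ (@inner_continuous R V y (Z x)) (YZ x)).
  have lim2 : inner (Y n x) y @[n --> \oo] --> inner x (Z y).
    under eq_fun do rewrite half_square_iter_sym inner_sym.
    rewrite inner_sym.
    exact: (continuous_cvg _ (@inner_continuous R V x (Z y)) (YZ y)).
  exact: (cvg_unique _ lim1 lim2).
have Y2 : Y n (Y n x) @[n --> \oo] --> Z (Z x).
  have d0 : (Y n x - Z x) @[n --> \oo] --> 0.
    by rewrite -(subrr (Z x)); apply: cvgB => //; exact: cvg_cst.
  have d1 : Y n (Y n x - Z x) @[n --> \oo] --> 0.
    apply/cvgrPdist_le => e e0; move/cvgrPdist_le: d0 => /(_ e e0).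
    apply: filterS => n; rewrite !sub0r !normrN => xe.
    rewrite (le_trans (half_square_iter_bound _ _))// (le_trans _ xe)//.
    by rewrite ler_piMl// ltW.
  have -> : (fun n => Y n (Y n x)) = (fun n => Y n (Y n x - Z x) + Y n (Z x)).
    by apply/funext => n; rewrite half_square_iterB subrK.
  by rewrite -[Z (Z x)]add0r; apply: cvgD.
have lim1 : Y n.+1 x @[n --> \oo] --> 2^-1 *: (B x + Z (Z x)).
  by apply: cvgZr; apply: cvgD => //; exact: cvg_cst.
have lim2 : Y n.+1 x @[n --> \oo] --> Z x.
  by have := YZ x; rewrite -(cvg_shiftS (Y^~ x)).
have ZxE := cvg_unique _ lim2 lim1.
rewrite {1 2}ZxE// -scalerDl; have -> : 2^-1 + 2^-1 = 1 :> R by field.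
by rewrite scale1r.
Qed.

End Iteration.

(** With a step [t] making [B = Id - t U] a contraction, the solution [Z] of
    [2 Z = B + Z ^ 2] satisfies [(Id - Z) ^ 2 = t U]. *)
Lemma sqrt_opP (U : {linear V -> V}) :
  bounded_operator U -> self_adjoint U -> strongly_monotone U%:op ->
  [/\ linear (sqrt_op U), bounded_operator (sqrt_op U),
      self_adjoint (sqrt_op U), forall x, 0 <= inner x (sqrt_op U x) &
      forall x, sqrt_op U (sqrt_op U x) = U x].
Proof.
move=> U_bounded U_sa U_mono; rewrite /sqrt_op; case: xgetP => [_ -> //|no_S].
exfalso.
have [t [q [t0 q01 Uq]]] := strongly_monotone_step U_bounded U_mono.
have B_lin : linear (fun x => x - t *: U x).
  move=> a x y; rewrite linearP scalerDr scalerA mulrC -scalerA.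
  by rewrite opprD addrACA scalerBr.
pose B : {linear V -> V} := HB.pack (fun x => x - t *: U x)
  (GRing.isLinear.Build _ _ _ _ _ B_lin).
have B_sym x y : inner (B x) y = inner x (B y).
  by rewrite /B/= innerBl innerBr innerZl innerZr adjointE// U_sa.
have [Z [Z_lin Z_bound Z_sym ZE]] := @half_square_fixed_point B q q01 Uq B_sym.
pose s := (Num.sqrt t)^-1.
have s0 : 0 < s by rewrite invr_gt0 sqrtr_gt0.
have ss : s * s * t = 1.
  rewrite /s -invfM -expr2 sqr_sqrtr ?ltW// mulVf//.
  by rewrite gt_eqF.
pose S x := s *: (x - Z x).
have S_lin : linear S.
  move=> a x y; rewrite /S Z_lin opprD addrACA -scalerBr scalerDr.
  by rewrite !scalerA mulrC.
have [q0 q1] := andP q01.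
pose S' : {linear V -> V} := HB.pack S (GRing.isLinear.Build _ _ _ _ _ S_lin).
have ZB x y : Z (x - y) = Z x - Z y.
  by rewrite addrC -scaleN1r Z_lin scaleN1r addrC.
have ZZ a x : Z (a *: x) = a *: Z x.
  have Z0 : Z 0 = 0 by have := ZB 0 0; rewrite !subrr.
  by rewrite -[a *: x]addr0 Z_lin Z0 addr0.
apply: (no_S S); split=> //.
- apply/(bounded_operatorP S'); exists (s * 2) => [|x].
    by rewrite mulr_gt0.
  rewrite /S'/= normrZ gtr0_norm// -mulrA ler_pM2l//.
  rewrite (le_trans (ler_normB _ _))// mulr_natl mulr2n lerD2l.
  by rewrite (le_trans (Z_bound x))// ler_piMl// ltW.
- apply/funext => y; apply: adjoint_unique => x.
  by rewrite /S innerZl innerZr innerBl innerBr Z_sym.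
- move=> x; rewrite innerZr; apply: mulr_ge0; first exact: ltW.
  rewrite innerBr subr_ge0.
  rewrite (le_trans (ler_norm _))// (le_trans (cauchy_schwarz _ _))//.
  rewrite inner_normE expr2 ler_wpM2l// (le_trans (Z_bound x))//.
  by rewrite ler_piMl// ltW.
- move=> x; rewrite /S ZZ ZB -scalerBr scalerA.
  have -> : x - Z x - (Z x - Z (Z x)) = t *: U x.
    have -> : t *: U x = x + Z (Z x) - (Z x + Z x).
      by rewrite ZE /B/= opprD opprB addrACA subrr addr0 addrC subrK.
    by rewrite opprB opprD addrACA addrA.
  by rewrite scalerA ss scale1r.
Qed.

End SquareRoot.

(** * Set-valued operators and monotonicity *)

Section Operators.

Lemma op_comp_map (T S X : Type) (B : S -> set X) (f : T -> S) :
  B \oc f%:op = B \o f.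
Proof. by apply/funext => x; rewrite /op_comp /op_of bigcup_set1. Qed.

Lemma map_op_comp (T S X : Type) (f : S -> X) (A : T -> set S) :
  f%:op \oc A = fun x => f @` A x.
Proof.
by apply/funext => x; apply/seteqP; split=> y [z Az]; exists z.
Qed.

Lemma op_compA (T S X Y : Type) (C : X -> set Y) (B : S -> set X)
  (A : T -> set S) : C \oc (B \oc A) = C \oc B \oc A.
Proof.
apply/funext => x; apply/seteqP; split=> y.
  by move=> [z [w Aw Bz] Cy]; exists w => //; exists z.
by move=> [w Aw [z Bz Cy]]; exists z => //; exists w.
Qed.

Lemma op_addC (T : Type) (V : zmodType) (A B : T -> set V) : A \+o B = B \+o A.
Proof.
apply/funext => x; apply/seteqP.
by split=> _ [u Au [v Bv <-]]; exists v => //; exists u; rewrite // addrC.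
Qed.

(** For [w = z + v], the inclusion of [K v] in [A z] says that [K w] lies in
    [A z + K z]. Surjectivity of [K] provides [v] when only the element [K v]
    of [A z] is given. *)
Lemma resolvent_preconditioned (V : zmodType) (K : {additive V -> V})
  (A : V -> set V) : (forall y, exists x, K x = y) ->
  resolvent (K%:op^-1o \oc A) \oc K%:op^-1o = (A \+o K%:op)^-1o.
Proof.
move=> K_surj; apply/funext => h; apply/seteqP; split=> z.
  move=> [w /= ->] [_ /= -> [v [a Az aE] <-]].
  exists a => //; exists (K z) => //=.
  by rewrite raddfD (aE : a = K v) addrC.
move=> /= [a Az [_ /= -> <-]]; have [v Kv] := K_surj a.
exists (z + v); first by rewrite /op_inv/op_of/= raddfD Kv addrC.
by exists z => //; exists v => //; exists a.
Qed.

End Operators.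

Section Monotone.
Context {R : realType}.

Lemma maximally_monotone_inv (V : lmodType R) (ip : V -> V -> R)
    (A : V -> set V) :
  (forall x y, ip x y = ip y x) ->
  maximally_monotone ip A -> maximally_monotone ip A^-1o.
Proof.
move=> ip_sym [A_mono A_max]; split=> [x u y v Ax Ay|x u xu].
  by rewrite ip_sym; exact: A_mono.
by apply: A_max => y v Ay; rewrite ip_sym; exact: xu.
Qed.

Context {V : hilbertType R}.

(** The inner product of [P] absorbs the preconditioner:
    [inner_op P (x - y) (T u - T v) = inner (x - y) (u - v)]. *)
Lemma maximally_monotone_preconditioned (T P : {linear V -> V})
    (A : V -> set V) :
  cancel T P -> cancel P T -> maximally_monotone inner A ->
  maximally_monotone (inner_op P) (T%:op \oc A).
Proof.
move=> TK PK [A_mono A_max]; rewrite map_op_comp; split.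
  move=> x _ y _ [u Au <-] [v Av <-].
  by rewrite /inner_op -linearB TK; exact: A_mono.
move=> x w xw; exists (P w) => //; apply: A_max => y v Ay.
have := xw y (T v); rewrite /inner_op linearB TK; apply.
by exists v.
Qed.

(** Strong monotonicity survives inversion because [y = T (P y)] gives
    [inner y (P y) >= a |P y| ^ 2] while [|y| <= M |P y|]. *)
Lemma strongly_monotone_inverse (T : {linear V -> V}) (P : V -> V) :
  bounded_operator T -> strongly_monotone T%:op -> cancel P T ->
  [/\ linear P, bounded_operator P & strongly_monotone P%:op].
Proof.
move=> /bounded_operatorP[M M0 TM] T_mono PK.
have TK : cancel T P by move=> x; apply: (strongly_monotone_inj T_mono).
have /linear_strongly_monotoneP[a a0 Ta] := T_mono.
have P_lin : linear P by move=> b x y; apply: (can_inj TK); rewrite linearP !PK.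
pose P' : {linear V -> V} := HB.pack P (GRing.isLinear.Build _ _ _ _ _ P_lin).
split=> //.
  apply/(bounded_operatorP P'); exists a^-1 => [|y]; first by rewrite invr_gt0.
  rewrite ler_pdivlMl//; have [->|Py0] := eqVneq (P' y) 0.
    by rewrite normr0 mulr0.
  rewrite -(@ler_pM2r _ `|P y|) ?normr_gt0// -mulrA -expr2.
  rewrite (le_trans (Ta (P y)))// PK (le_trans (ler_norm _))// mulrC.
  exact: cauchy_schwarz.
apply/(linear_strongly_monotoneP P'); exists (a / M ^+ 2) => [|y].
  by rewrite divr_gt0 ?exprn_gt0.
have := Ta (P y); rewrite PK inner_sym; apply: le_trans.
rewrite -mulrA ler_pM2l// ler_pdivrMl ?exprn_gt0// -exprMn.
by rewrite ler_pXn2r ?nnegrE ?mulr_ge0 ?(ltW M0)// -{1}(PK y).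
Qed.

(** Boundedness and strong monotonicity of [P] make the norm of [inner_op P]
    equivalent to the original one, which transports completeness. *)
Lemma hilbert_inner_product_op (P : {linear V -> V}) :
  bounded_operator P -> self_adjoint P -> strongly_monotone P%:op ->
  hilbert_inner_product (inner_op P).
Proof.
move=> P_bounded P_sa /linear_strongly_monotoneP[a a0 Pa].
have /bounded_operatorP[M M0 PM] := P_bounded.
have norm_le x : Num.sqrt a * `|x| <= Num.sqrt (inner_op P x x).
  rewrite -[`|x|]normr_id -sqrtr_sqr -sqrtrM ?(ltW a0)//.
  by apply: ler_wsqrtr; exact: Pa.
have norm_ge x : Num.sqrt (inner_op P x x) <= Num.sqrt M * `|x|.
  rewrite -[`|x|]normr_id -sqrtr_sqr -sqrtrM ?(ltW M0)//.
  apply: ler_wsqrtr; rewrite (le_trans (ler_norm _))//.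
  by rewrite (le_trans (cauchy_schwarz _ _))// expr2 mulrCA ler_wpM2l.
have sa0 : 0 < Num.sqrt a by rewrite sqrtr_gt0.
have sM0 : 0 < Num.sqrt M by rewrite sqrtr_gt0.
split.
- by move=> x y; rewrite /inner_op -{1}P_sa -adjointE// inner_sym.
- by move=> b x y z; rewrite /inner_op innerDl innerZl.
- move=> x x0; apply: lt_le_trans (Pa x).
  by rewrite mulr_gt0// exprn_gt0// normr_gt0.
- move=> u u_cauchy; have u_cvg : cvgn u.
    apply: cauchy_seq_cvg => e e0.
    have [N uN] := u_cauchy (Num.sqrt a * e) (mulr_gt0 sa0 e0).
    exists N => m n Nm Nn; rewrite -(@ltr_pM2l _ (Num.sqrt a))//.
    exact: le_lt_trans (norm_le _) (uN m n Nm Nn).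
  exists (limn u) => e e0; have e1 : 0 < e / Num.sqrt M by rewrite divr_gt0.
  have [N _ uN] := @cvgr_dist_lt _ _ _ _ _ _ _ u_cvg _ e1.
  exists N => n Nn; apply: le_lt_trans (norm_ge _) _.
  by rewrite mulrC -ltr_pdivlMr// distrC; exact: uN.
Qed.

End Monotone.

(** * Parallel composition *)

Section Parallel.
Context {R : realType} {H G : hilbertType R}.

(** For [x = T z] with [T^* u] in [A z], the inclusion
    [y = x + Q u] says [u = P (y - T z)], that is
    [T^* P y] lies in [A z + T^* P T z]. *)
Lemma resolvent_parallel_composition (A : H -> set H) (T : {linear H -> G})
    (Q P : {linear G -> G}) :
  bounded_operator T -> cancel Q P -> cancel P Q ->
  resolvent (Q%:op \oc parallel_composition T A) =
  T%:op \oc (A \+o (adjoint T \o P \o T)%:op)^-1o \oc (adjoint T)%:op \oc P%:op.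
Proof.
move=> T_bounded QK PK.
have [Ts TsE] := linear_bundle (adjoint_linear T_bounded).
rewrite /parallel_composition TsE !op_comp_map !map_op_comp.
apply/funext => y; apply/seteqP; split=> x.
  move=> [_ -> [_ [u [z Az <-] <-] <-]]; exists z => //=.
  exists (Ts u) => //; exists (Ts (P (T z))) => //.
  by rewrite [P (_ + _)]linearD QK linearD addrC.
move=> [z /= [a Az [_ /= -> az]] <-].
have uE : a = Ts (P (y - T z)) by rewrite !linearB -az addrK.
exists (T z) => //; exists (Q (P (y - T z))); last by rewrite PK /= addrC subrK.
exists (P (y - T z)) => //.
by exists z => //; rewrite /op_inv/= -uE.
Qed.

(** Every functional [inner z] is [inner (T z) w] for some [w], so the vectors
    [z] with [`|T z| <= 1] are pointwise, hence uniformly, bounded. *)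
Lemma adjoint_surj_bounded_below (T : {linear H -> G}) :
  bounded_operator T -> range (adjoint T) = [set: H] ->
  exists2 c : R, 0 < c & forall x, `|x| <= c * `|T x|.
Proof.
move=> T_bounded T_surj.
pose F := [set f : H -> R^o | exists2 x, `|T x| <= 1 & f = inner^~ x].
have [f [x Tx ->]|z|M MF] := @Banach_Steinhauss R H R^o F _ _ 1.
- split; last by move=> b y z; rewrite innerDl innerZl.
  move=> r; exists (r * `|x|) => y yr.
  by rewrite (le_trans (cauchy_schwarz _ _))// ler_wpM2r.
- have [w _ wz] : range (adjoint T) z by rewrite T_surj.
  exists `|w| => f [x Tx ->]; rewrite inner_sym -wz -adjointE//.
  by rewrite (le_trans (cauchy_schwarz _ _))// ler_piMl.
have M0 : 0 <= M.
  have F0 : F (inner^~ 0) by exists 0; rewrite // [T 0]linear0 normr0.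
  by apply: le_trans (normr_ge0 _) (MF _ F0 0 _); rewrite normr0.
have bound x : `|T x| <= 1 -> `|x| <= M.
  move=> Tx; have [->|x0] := eqVneq x 0; first by rewrite normr0.
  have Fx : F (inner^~ x) by exists x.
  have := MF _ Fx (`|x|^-1 *: x).
  rewrite normrZ normfV normr_id mulVf ?normr_eq0// innerZl inner_normE.
  by rewrite expr2 mulKf ?normr_eq0// normr_id; apply.
exists (M + 1) => [|x]; first by rewrite ltr_wpDl.
apply: (@le_trans _ _ (M * `|T x|)); last by rewrite ler_wpM2r// lerDl.
apply/ler_addgt0Pr => e e0.
(* Rescaling by [`|T x| + d] rather than [`|T x|] covers [T x = 0]. *)
pose d := e / (M + 1); pose s := `|T x| + d.
have M1 : 0 < M + 1 by rewrite ltr_wpDl.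
have d0 : 0 < d by rewrite divr_gt0.
have s0 : 0 < s by rewrite ltr_wpDl.
have := bound (s^-1 *: x); rewrite linearZ/= !normrZ gtr0_norm ?invr_gt0//.
rewrite !ler_pdivrMl// mulr1 lerDl (ltW d0) => /(_ isT) x_le.
rewrite (le_trans x_le)// mulrC mulrDr lerD2l /d mulrA ler_pdivrMr//.
by rewrite mulrC ler_wpM2l ?(ltW e0)// lerDl.
Qed.

End Parallel.

Theorem corollary3p3 (R : realType) (H G : hilbertType R)
    (A : H -> set H) (L : {linear H -> G}) (U : {linear G -> G})
    (A_max : maximally_monotone inner A)
    (L_bounded : bounded_operator L)
    (LAL_max : maximally_monotone inner
       (L%:op \oc A^-1o \oc (adjoint L)%:op))
    (U_bounded : bounded_operator U)
    (U_self_adjoint : self_adjoint U)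
    (U_strongly_monotone : strongly_monotone U%:op) :
  let Ls : G -> H := adjoint L in
  let Ui : G -> G := map_of (V := G) U%:op^-1o in
  let sqrtUi : G -> G := map_of (V := G) (sqrt_op U)%:op^-1o in
  let K : H -> H := Ls \o Ui \o L in
  let B : G -> set G := (U : G -> G)%:op \oc parallel_composition L A in
  [/\ hilbert_inner_product (inner_op Ui) /\
        maximally_monotone (inner_op Ui) B,
      resolvent B =
        L%:op \oc (A \+o K%:op)^-1o \oc Ls%:op \oc Ui%:op,
      closed (range L) ->
        resolvent B =
          L%:op \oc warped_resolvent K A
            \oc (moore_penrose (sqrtUi \o L))%:op \oc sqrtUi%:op
    & range Ls = [set: H] ->
        resolvent B =
          L%:op \oc resolvent (K%:op^-1o \oc A)
            \oc K%:op^-1o \oc Ls%:op \oc Ui%:op].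
Proof.
move=> Ls Ui sqrtUi K B.
have UiK : cancel Ui U.
  exact: map_of_invK (strongly_monotone_surj U_bounded U_strongly_monotone).
have UK : cancel U Ui.
  by move=> y; apply: (strongly_monotone_inj U_strongly_monotone); rewrite UiK.
have [Ui_lin Ui_bounded Ui_mono] :=
  strongly_monotone_inverse U_bounded U_strongly_monotone UiK.
have [P PE] := linear_bundle Ui_lin.
have [Lst LstE] := linear_bundle (adjoint_linear L_bounded).
rewrite PE in UiK UK Ui_bounded Ui_mono.
have P_sa : self_adjoint P.
  apply/funext => y; apply: adjoint_unique => z.
  by rewrite -{1}(UiK y) -self_adjointE// UiK.
have resolventE : resolvent B =
    L%:op \oc (A \+o K%:op)^-1o \oc Ls%:op \oc Ui%:op.
  by rewrite /K PE; exact: resolvent_parallel_composition.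
split=> //.
- rewrite PE; split; first exact: hilbert_inner_product_op.
  apply: maximally_monotone_preconditioned => //.
  apply: maximally_monotone_inv LAL_max; exact: inner_sym.
- move=> L_closed; rewrite resolventE.
  have [S_lin S_bounded S_sa _ SS] :=
    sqrt_opP U_bounded U_self_adjoint U_strongly_monotone.
  have [S SE] := linear_bundle S_lin.
  rewrite SE in S_bounded S_sa SS.
  (* [S] is bijective because [S \o S = U] is. *)
  have sK : cancel sqrtUi S.
    rewrite /sqrtUi SE; apply: map_of_invK => y; exists (S (P y)).
    by rewrite SS UiK.
  have Ks : cancel S sqrtUi.
    move=> y; have := congr1 P (SS (sqrtUi (S y))).
    by rewrite sK UK SS UK.
  have sE y : sqrtUi y = S (P y) by rewrite -[y in LHS]UiK -SS Ks.
  (* The adjoint of [sL = S^-1 L] is [L^* S^-1], and [S^-1 S^-1 = U^-1], so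
     that the normal equation of [sL] is [K x = L^* U^-1 y]. *)
  have [sL sLE] : exists sL : {linear H -> G}, sqrtUi \o L = sL.
    by exists (S \o P \o L); apply/funext => x; exact: sE.
  have sL_sym z y : inner (sL z) y = inner z (Ls (sqrtUi y)).
    rewrite -sLE /= -adjointE// -{1}(sK y) -self_adjointE//.
    by rewrite sK.
  have sL_adj y : adjoint sL y = Ls (sqrtUi y).
    exact: adjoint_unique.
  have ssE y : sqrtUi (sqrtUi y) = P y.
    by rewrite -{1}(UiK y) -SS !Ks.
  have sL_bounded : bounded_operator sL.
    have -> : sL = S \o (P \o L) :> (H -> G).
      by rewrite -sLE; apply/funext => x; exact: sE.
    by apply: bounded_operator_comp => //; exact: bounded_operator_comp.
  have sL_closed : closed (range sL).
    have -> : range sL = S @^-1` range L.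
      rewrite -sLE; apply/seteqP; split=> [_ [x _ <-]|y [x _ Lx]].
        by exists x => //=; rewrite sK.
      by exists x => //=; rewrite Lx Ks.
    by apply: closed_comp => // y _; move: y; exact/linear_bounded_continuous.
  have normal_eq y : K (moore_penrose sL (sqrtUi y)) = Ls (P y).
    have := moore_penrose_normal_eq (sqrtUi y) sL_bounded sL_closed.
    by rewrite !sL_adj -sLE /= !ssE /K PE.
  rewrite /warped_resolvent op_addC !op_compA !op_comp_map sLE PE.
  by apply/funext => y /=; rewrite normal_eq.
- move=> Ls_surj; rewrite resolventE.
  have [c c0 Lc] := adjoint_surj_bounded_below L_bounded Ls_surj.
  have [K' K'E] : exists K' : {linear H -> H}, K = K'.
    by exists (Lst \o P \o L); rewrite /K PE /Ls LstE.
  (* [K] is strongly monotone: [inner x (K x) = inner (L x) (U^-1 (L x))]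
     dominates [|L x| ^ 2], hence [|x| ^ 2]. *)
  have K_surj y : exists x, K' x = y.
    apply: strongly_monotone_surj.
      have -> : K' = Lst \o (P \o L) :> (H -> H).
        by rewrite -K'E /K PE /Ls LstE.
      apply: bounded_operator_comp; last exact: bounded_operator_comp.
      by rewrite -LstE; exact: adjoint_bounded.
    have /linear_strongly_monotoneP[a a0 Pa] := Ui_mono.
    apply/linear_strongly_monotoneP; exists (a / c ^+ 2) => [|x].
      by rewrite divr_gt0// exprn_gt0.
    rewrite -K'E /K /= -adjointE// PE; apply: le_trans (Pa (L x)).
    rewrite -mulrA ler_pM2l// ler_pdivrMl ?exprn_gt0// -exprMn.
    by rewrite ler_pXn2r ?nnegrE ?mulr_ge0 ?(ltW c0).
  by rewrite K'E -(resolvent_preconditioned A K_surj) op_compA.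
Qed.
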